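(* Let $K$ be a field of characteristic zero, let $n$ be a positive integer, and let $\Gamma$ be the set of all nonunital intersections in $\mathcal{M}_n(K)$. If $\mathcal{N} \in \Gamma$, then $\dim_K \mathcal{N} \le (n-1)(n-2)$.
   Context: $\mathcal{M}_n(K)$ is the algebra of $n\times n$ matrices over $K$. A subalgebra of $\mathcal{M}_n(K)$ is a $K$-linear subspace closed under matrix multiplication; it need not contain the identity matrix $I$. A subalgebra is called unital if it has a (two-sided) multiplicative identity (unity) of its own, which need not equal $I$; it is called nonunital if it has no such unity. A nonunital intersection in $\mathcal{M}_n(K)$ is a nonunital subalgebra $\mathcal{N}\subset \mathcal{M}_n(K)$ such that $\mathcal{N} = \mathcal{U}\cap\mathcal{V}$ for some two unital subalgebras $\mathcal{U},\mathcal{V}\subset\mathcal{M}_n(K)$ (whose unities need not be $I$ and need not coincide). *)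

(* Defs.v *)
From mathcomp Require Import all_boot all_order all_algebra.
Set Implicit Arguments.
Unset Strict Implicit.
Unset Printing Implicit Defensive.

Import GRing.Theory.
Local Open Scope ring_scope.

(* {vspace 'M[K]_n} ranges over all K-linear subspaces of the n x n matrices.
   We do not use {aspace _}: it requires a unity, and a nonzero one. *)

Definition is_subalgebra (K : fieldType) (n : nat) (A : {vspace 'M[K]_n}) : Prop :=
  forall X Y : 'M[K]_n, X \in A -> Y \in A -> X *m Y \in A.

(* Neither E = 1%:M nor E != 0 is required, so the zero subalgebra is unital. *)
Definition is_unity (K : fieldType) (n : nat) (A : {vspace 'M[K]_n})
    (E : 'M[K]_n) : Prop :=
  E \in A /\ (forall X : 'M[K]_n, X \in A -> E *m X = X /\ X *m E = X).

Definition unital_subalgebra (K : fieldType) (n : nat)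
    (A : {vspace 'M[K]_n}) : Prop :=
  is_subalgebra A /\ exists E : 'M[K]_n, is_unity A E.

Definition nonunital_subalgebra (K : fieldType) (n : nat)
    (A : {vspace 'M[K]_n}) : Prop :=
  is_subalgebra A /\ ~ (exists E : 'M[K]_n, is_unity A E).

Definition nonunital_intersection (K : fieldType) (n : nat)
    (N : {vspace 'M[K]_n}) : Prop :=
  nonunital_subalgebra N /\
  exists U V : {vspace 'M[K]_n},
    [/\ unital_subalgebra U, unital_subalgebra V & N = (U :&: V)%VS].

(* Main.v *)
Require Import Defs.
From mathcomp Require Import all_boot all_order all_algebra.
From mathcomp Require Import zify.
Set Implicit Arguments.
Unset Strict Implicit.
Unset Printing Implicit Defensive.

Import GRing.Theory.
Local Open Scope ring_scope.

(** Why the bound holds.  Let E and F be the unities of U and V.  They are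
idempotents, and each acts as the identity on N from both sides.  If both were
equal to the identity matrix, the identity would lie in the intersection N and
be a unity of it; so one of them, say F, has rank q < n.  Then N lies in the
corner algebra F M_n(K) F, which is isomorphic to M_q(K), and there its image
is a subalgebra that does not contain the identity
([nonunital_corner_dim]).

So it remains to see that a subalgebra A of M_m(K) without the identity has
dimension at most m(m - 1) ([subalgebra_without_1_dim]); with m = q <= n - 1
this gives (n - 1)(n - 2).  Suppose that the codimension of A is less than m.
For a nonzero column v the matrices v w, with w ranging over all rows, form an
m-dimensional space, so A contains one with w nonzero.  The rows w with v w in
A form a space W_v that is stable under right multiplication by A.  If W_v is
everything for every basis vector v, then A contains all matrix units and hence
the identity.  Otherwise some W_v is a proper nonzero subspace, stable under
A + K 1.  Stabilizing a space of dimension r imposes r(m - r) >= m - 1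
independent linear conditions ([stable_algebra_dim]), so
dim A + 1 = dim (A + K 1) <= m^2 - m + 1. *)

(** * Subalgebras with a stable subspace *)

(** The two factors are kept behind existential quantifiers, with the rank as
a variable [r]: the statement then allows rewriting with [C *m R = A] although
the sizes of the factors depend on [A]. *)
Lemma rank_factorization (K : fieldType) (m n : nat) (A : 'M[K]_(m, n)) :
  exists r (C : 'M_(m, r)) (C' : 'M_(r, m)) (R : 'M_(r, n)) (R' : 'M_(n, r)),
    [/\ r = \rank A, C *m R = A, C' *m C = 1%:M & R *m R' = 1%:M].
Proof.
exists (\rank A), (col_base A), (pinvmx (col_base A)).
exists (row_base A), (pinvmx (row_base A)).
by rewrite mulmx_base mulVpmx ?col_base_full // mulmxVp ?row_base_free.
Qed.

Lemma dim_fullv_mx (K : fieldType) (p q : nat) :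
  \dim {:'M[K]_(p, q)} = (p * q)%N.
Proof. by rewrite dimvf dim_matrix. Qed.

(** The map [a |-> B *m a *m X] has rank [\rank B * \rank X]: factoring
[B = C R] and [X = D S], it vanishes exactly where [a |-> R *m a *m D] does,
and the latter is onto because [R] has a right inverse and [D] a left one. *)
Lemma dim_sandwich_kernel (K : fieldType) (l m k : nat)
    (B : 'M[K]_(l, m)) (X : 'M[K]_(m, k)) (A : {vspace 'M[K]_m}) :
  (forall a, a \in A -> B *m a *m X = 0) ->
  (\dim A + \rank B * \rank X <= m * m)%N.
Proof.
move=> BAX0.
have [r [C [C' [R [R' [<- CR C'C RR']]]]]] := rank_factorization B.
have [s [D [D' [S [S' [<- DS D'D SS']]]]]] := rank_factorization X.
pose f := linfun (mulmxr D \o mulmx R).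
have fE a : f a = R *m a *m D by rewrite lfunE.
have A_ker : (A <= lker f)%VS.
  apply/subvP=> a /BAX0 BaX0; rewrite memv_ker fE; apply/eqP.
  transitivity (C' *m (B *m a *m X) *m S').
    by rewrite -CR -DS !mulmxA C'C mul1mx -[RHS]mulmxA SS' mulmx1.
  by rewrite BaX0 mulmx0 mul0mx.
have f_onto : (fullv <= limg f)%VS.
  apply/subvP=> Y _; apply/memv_imgP; exists (R' *m Y *m D'); rewrite ?memvf //.
  by rewrite fE !mulmxA RR' mul1mx -mulmxA D'D mulmx1.
have := limg_ker_dim f fullv.
rewrite capfv dim_fullv_mx => <-.
by rewrite leq_add ?dimvS // -(dim_fullv_mx K) dimvS.
Qed.

(** Stability of the row space of [B] under [a] is the equation
[B *m a *m cokermx B = 0], which amounts to r (m - r) independent conditions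
for r the rank of [B]; this is least, namely m - 1, when r is 1 or m - 1. *)
Lemma stable_algebra_dim (K : fieldType) (m : nat)
    (B : 'M[K]_m) (A : {vspace 'M[K]_m}) :
  (forall a, a \in A -> stablemx B a) -> (0 < \rank B < m)%N ->
  (\dim A + m <= (m * m).+1)%N.
Proof.
move=> stabA /andP[B_gt0 B_lt].
have /dim_sandwich_kernel : forall a, a \in A -> B *m a *m cokermx B = 0.
  by move=> a /stabA; rewrite submxE => /eqP.
rewrite mxrank_coker.
move: (\rank B) B_gt0 B_lt => r r_gt0 r_lt bound.
have le_m : (m <= (r * (m - r)).+1)%N.
  rewrite -{1}(subnKC (ltnW r_lt)).
  have : (0 < m - r)%N by rewrite subn_gt0.
  case: r r_gt0 {bound r_lt} => // r _; case: (m - r.+1)%N => // k _.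
  by rewrite mulnS mulSn; lia.
by lia.
Qed.

(** * Subalgebras avoiding the identity *)

(** A subalgebra of codimension less than m contains, for every nonzero column
v, some nonzero matrix v w; the rows w with v w in the subalgebra form
an invariant subspace, which is what forces the bound.  The value m(m - 1) is
attained, for instance by the matrices whose first column is zero. *)
Lemma subalgebra_without_1_dim (K : fieldType) (m : nat)
    (A : {vspace 'M[K]_m}) :
  is_subalgebra A -> 1%:M \notin A -> (\dim A <= m * (m - 1))%N.
Proof.
move=> algA A'1; rewrite mulnBr muln1 leqNgt ltn_subLR; last first.
  by case: (m) => // n; rewrite leq_pmulr.
apply/negP=> bigA.
pose f (i : 'I_m) : 'Hom('rV[K]_m, 'M[K]_m) :=
  linfun (mulmx (delta_mx i (0 : 'I_1))).
have fE i w : f i w = delta_mx i 0 *m w by rewrite lfunE.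
pose W i := (f i @^-1: A)%VS.
have memW i w : (w \in W i) = (delta_mx i 0 *m w \in A).
  by rewrite -memv_preim fE.
(* W i full for all i puts every matrix unit in A, hence also the identity. *)
have [/forallP fullW | ] := boolP [forall i, W i == fullv].
  case/negP: A'1; rewrite mx1_sum_delta memv_suml // => i _.
  rewrite -[delta_mx i i](mul_delta_mx (0 : 'I_1)) -memW.
  by rewrite (eqP (fullW i)) memvf.
case/forallPn=> i W_proper.
(* The matrix of a projection onto W i has W i as its row space. *)
pose B := lin1_mx (projv (W i)).
have BE (u : 'rV_m) : u *m B = projv (W i) u by rewrite mul_rV_lin1.
have subB (u : 'rV_m) : (u <= B)%MS = (u \in W i).
  apply/submxP/idP=> [[D ->] | /projv_id <-]; first by rewrite BE memv_proj.
  by exists u; rewrite BE.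
have B_neq0 : B != 0.
  (* A and the m-dimensional image of f i are too large to be disjoint. *)
  have f_inj : lker (f i) == 0%VS.
    apply/lker0P=> u v; rewrite !fE => /(congr1 (mulmx (delta_mx (0 : 'I_1) i))).
    by rewrite !mulmxA !mul_delta_mx [delta_mx 0 0]mx11_scalar mxE !mul1mx.
  have : (0 < \dim (limg (f i) :&: A))%N.
    rewrite -(ltn_add2l (\dim (limg (f i) + A))) addn0 dimv_sum_cap.
    rewrite limg_dim_eq ?(eqP f_inj) ?capv0 // dim_fullv_mx mul1n.
    by apply: leq_ltn_trans bigA; rewrite -(dim_fullv_mx K) dimvS ?subvf.
  rewrite lt0n dimv_eq0 -vpick0; set X := vpick _ => X_neq0.
  have /memv_capP[/memv_imgP[w _ Xw] AX] := memv_pick (limg (f i) :&: A)%VS.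
  apply: contra_neq X_neq0 => B0; rewrite /X Xw.
  have : w \in W i by rewrite memW -fE -Xw.
  by rewrite -subB B0 submx0 => /eqP->; rewrite linear0.
have B_nfull : (\rank B < m)%N.
  rewrite ltn_neqAle rank_leq_row andbT; apply: contra W_proper => fullB.
  rewrite eqEsubv subvf /=; apply/subvP=> u _.
  by rewrite -subB submx_full.
(* Stability holds for A + K 1 as well: this gains the one dimension by which
   the stabilizer of W i can exceed m (m - 1). *)
have stabB a : a \in (A + <[1%:M]>)%VS -> stablemx B a.
  case/memv_addP=> x Ax [_ /vlineP[c ->] ->].
  rewrite scalemx1 stablemxD ?stablemxC //.
  apply/row_subP=> j; rewrite row_mul subB memW mulmxA algA // -memW -subB.
  exact: row_sub.
have := stable_algebra_dim stabB; rewrite lt0n mxrank_eq0 B_neq0 B_nfull.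
move/(_ isT).
rewrite dimv_disjoint_sum; last first.
  apply/eqP; rewrite -subv0; apply/subvP=> x /memv_capP[Ax /vlineP[c xE]].
  move: Ax; rewrite xE; have [-> | c_neq0] := eqVneq c 0.
    by rewrite scale0r memv0.
  by rewrite rpredZeq (negPf c_neq0) (negPf A'1).
rewrite dim_vline.
case: eqP => [one0 | _]; first by rewrite one0 mem0v in A'1.
by lia.
Qed.

(** * Corners and intersections *)

(** Write [F = C R] with inner size the rank of [F].  The map
[X |-> R *m X *m C] into square matrices of that size is injective on [N],
since C (R X C) R = F X F = X, and multiplicative there, since
R X C R Y C = R X F Y C.  If its image contained the identity, R X C = 1 would
give X = C R = F, and [F] would be a unity of [N]. *)
Lemma nonunital_corner_dim (K : fieldType) (n : nat) (F : 'M[K]_n)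
    (N : {vspace 'M[K]_n}) :
  (forall X, X \in N -> F *m X = X /\ X *m F = X) ->
  nonunital_subalgebra N -> (\dim N <= \rank F * (\rank F - 1))%N.
Proof.
move=> unitF [algN nounit].
have [r [C [_ [R [_ [<- CR _ _]]]]]] := rank_factorization F.
have unitCR X : X \in N -> C *m (R *m X *m C) *m R = X.
  by case/unitF=> FX XF; rewrite !mulmxA CR FX -mulmxA CR XF.
pose g : 'Hom('M[K]_n, 'M[K]_r) := linfun (mulmxr C \o mulmx R).
have gE X : g X = R *m X *m C by rewrite lfunE.
have g_inj : (N :&: lker g = 0)%VS.
  apply/eqP; rewrite -subv0; apply/subvP=> X /memv_capP[NX].
  rewrite memv_ker gE => /eqP gX0.
  by rewrite -[X]unitCR // gX0 mulmx0 mul0mx mem0v.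
rewrite -(limg_dim_eq g_inj); apply: subalgebra_without_1_dim.
  move=> _ _ /memv_imgP[X NX ->] /memv_imgP[Y NY ->].
  rewrite !gE; apply/memv_imgP; exists (X *m Y); rewrite ?algN // gE.
  have [FY _] := unitF Y NY.
  by rewrite -{2}FY -CR !mulmxA.
apply/negP=> /memv_imgP[X NX]; rewrite gE => X1.
have XF : X = F by rewrite -[X]unitCR // -X1 mulmx1 CR.
by apply: nounit; exists F; split=> //; rewrite -XF.
Qed.

Theorem theorem3p1 (K : fieldType) (charK0 : [pchar K] =i pred0)
    (n : nat) (n_gt0 : (0 < n)%N)
    (N : {vspace 'M[K]_n}) (hN : nonunital_intersection N) :
  (\dim N <= (n - 1) * (n - 2))%N.
Proof.
have [nonunN [U [V [[_ [E [UE unitE]]] [_ [F [VF unitF]]] NUV]]]] := hN.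
have small G : (forall X, X \in N -> G *m X = X /\ X *m G = X) ->
    (\rank G < n)%N -> (\dim N <= (n - 1) * (n - 2))%N.
  move=> unitG G_lt.
  apply: leq_trans (nonunital_corner_dim unitG nonunN) _.
  by rewrite leq_mul //; lia.
have full_id (G : 'M[K]_n) : G *m G = G -> (n <= \rank G)%N -> G = 1%:M.
  move=> GG G_ge; have G_unit : G \in unitmx.
    by rewrite -row_free_unit /row_free eqn_leq rank_leq_row.
  by rewrite -[LHS](mulKmx G_unit) GG mulVmx.
have EE : E *m E = E by case: (unitE E UE).
have FF : F *m F = F by case: (unitF F VF).
have NU X : X \in N -> X \in U by rewrite NUV => /memv_capP[].
have NV X : X \in N -> X \in V by rewrite NUV => /memv_capP[].
have [E_lt | /(full_id _ EE) E1] := ltnP (\rank E) n.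
  by apply: small E_lt => // X /NU /unitE.
have [F_lt | /(full_id _ FF) F1] := ltnP (\rank F) n.
  by apply: small F_lt => // X /NV /unitF.
case: nonunN => _ []; exists E; split; last by move=> X /NU /unitE.
by rewrite NUV memv_cap UE E1 -F1.
Qed.
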